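(* The set $\mathrm{REFL}_{\neg\mathrm{B}}=\{X\in\mathrm{SF}\mid X\text{ is reflexive and not normable}\}$ is $\Pi^1_1$-hard.
   Context: A Fréchet space is a completely metrizable locally convex topological vector space (real scalars) whose topology can be defined by an invariant metric. $C(\mathbb{R})$ is the Fréchet space of continuous real-valued functions on $\mathbb{R}$ with the topology of uniform convergence on compact sets. $\mathrm{SF}=\{X\subseteq C(\mathbb{R})\mid X\text{ is a closed vector subspace}\}$ with the Effros Borel structure, i.e., the $\sigma$-algebra generated by the sets $\{X\in\mathrm{SF}\mid X\cap U\neq\emptyset\}$, $U\subseteq C(\mathbb{R})$ open; it is a standard Borel space. $X\in\mathrm{SF}$ is normable if there is a norm on $X$ generating its topology. Reflexivity is the usual notion for locally convex spaces: the canonical map from $X$ into its strong bidual is an isomorphism onto. A subset $A$ of a standard Borel space $S$ is $\Pi^1_1$-hard if for every Polish space $Z$ and every coanalytic $B\subseteq Z$ there is a Borel map $f\colon Z\to S$ with $f^{-1}(A)=B$. *)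

(* Defs.v *)
From HB Require Import structures.
From mathcomp Require Import all_boot all_order all_algebra.
From mathcomp Require Import all_classical all_reals all_analysis.

Set Implicit Arguments.
Unset Strict Implicit.
Unset Printing Implicit Defensive.

Import Order.TTheory GRing.Theory Num.Theory.
Import numFieldNormedType.Exports.

Local Open Scope classical_set_scope.
Local Open Scope ring_scope.

Section convergence.
Context {R : realType}.

Lemma cvg_to_initial (S : choiceType) (T : topologicalType) (i : S -> T)
    (F : set_system S) (x : S) :
  Filter F -> i @ F --> i x -> F --> (x : initial_topology i).
Proof.
move=> FF ifx A /= [B [[C oC <-] Cx] CA].
by apply: (filterS CA); apply: ifx; exact: open_nbhs_nbhs.
Qed.

Lemma cvg_fst_comp (S T Y : Type) (F : set_system S) (G : set_system T)
    {FG : Filter G} (f : S -> Y) (H : set_system Y) :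
  f @ F `=>` H -> (fun x => f x.1) @ filter_prod F G `=>` H.
Proof.
move=> fFH P /fFH FP; exists (f @^-1` P, setT) => [|x []//].
by split=> //; exact: filterT.
Qed.

Lemma cvg_snd_comp (S T Y : Type) (F : set_system S) (G : set_system T)
    {FF : Filter F} (f : T -> Y) (H : set_system Y) :
  f @ G `=>` H -> (fun x => f x.2) @ filter_prod F G `=>` H.
Proof.
move=> fGH P /fGH GP; exists (setT, f @^-1` P) => [|x []//].
by split=> //; exact: filterT.
Qed.

Lemma fam_cvg_normP (U : choiceType) (fam : set U -> Prop) (X : Type)
    (F : set_system X) (f : X -> U -> R^o) (a : U -> R^o) :
  Filter F ->
  {family fam, f @ F --> a} <->
  (forall A, fam A -> forall e : R, 0 < e ->
    \forall x \near F, forall u, A u -> `|a u - f x u| < e).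
Proof.
move=> FF; split.
  move=> /fam_cvgP H A /H {}H e e0.
  have /H : nbhs (a : {uniform` A -> R^o}) [set h | forall u, A u -> ball (a u) e (h u)].
    apply/uniform_nbhs; exists [set xy | ball xy.1 e xy.2]; split => //.
    by rewrite -(@entourage_ballE R); exists e.
  by [].
move=> H; apply/fam_cvgP => A /H {}H P /uniform_nbhs [E [+ EP]].
rewrite -(@entourage_ballE R) => -[e /= e0 eE].
have := H _ e0; rewrite /nbhs /=; apply: filterS => x xP.
by apply: EP => u /xP ?; apply: eE.
Qed.

Lemma fam_cvgD (U : choiceType) (fam : set U -> Prop) (X : Type)
    (F : set_system X) (f g : X -> U -> R^o) (a b : U -> R^o) :
  Filter F -> {family fam, f @ F --> a} -> {family fam, g @ F --> b} ->
  {family fam, (fun x => f x + g x) @ F --> a + b}.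
Proof.
move=> FF /fam_cvg_normP fa /fam_cvg_normP gb; apply/fam_cvg_normP => A Ah e e0.
have e20 : 0 < e / 2 by rewrite divr_gt0.
near=> x => u Au.
have -> : (a + b) u - (f x + g x) u = (a u - f x u) + (b u - g x u).
  by rewrite -[(a + b) u]/(a u + b u) opprD addrACA.
apply: le_lt_trans (ler_normD _ _) _; rewrite (splitr e) ltrD//.
- by move: u Au; near: x; exact: fa.
- by move: u Au; near: x; exact: gb.
Unshelve. all: by end_near. Qed.

Lemma fam_cvgZ (U : choiceType) (fam : set U -> Prop) (X : Type)
    (F : set_system X) (k : X -> R^o) (f : X -> U -> R^o) (l : R^o)
    (a : U -> R^o) :
  Filter F ->
  (forall A, fam A -> exists M : R, forall u, A u -> `|a u| <= M) ->
  k @ F --> l -> {family fam, f @ F --> a} ->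
  {family fam, (fun x => k x *: f x) @ F --> l *: a}.
Proof.
move=> FF bnd kl /fam_cvg_normP fa; apply/fam_cvg_normP => A Ah e e0.
have [M0 aM0] := bnd _ Ah; pose M := `|M0| + 1; pose K := `|l| + 1.
have Mp : 0 < M by rewrite /M ltr_wpDl.
have Kp : 0 < K by rewrite /K ltr_wpDl.
have aM u : A u -> `|a u| <= M.
  by move=> /aM0 /le_trans; apply; rewrite /M ler_wpDr// ler_norm.
have e1 : 0 < e / 2 / M by rewrite !divr_gt0.
have e2 : 0 < e / 2 / K by rewrite !divr_gt0.
near=> x => u Au.
have -> : (l *: a) u - (k x *: f x) u =
    (l - k x) * a u + k x * (a u - f x u).
  by rewrite /GRing.scale /= mulrBl mulrBr addrA subrK.
have kK : `|k x| <= K.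
  have lk1 : `|l - k x| < 1 by near: x; move/cvgrPdist_lt : kl; exact.
  rewrite -(subrK l (k x)) (le_trans (ler_normD _ _))// addrC /K lerD2l.
  by rewrite distrC ltW.
have lkx : `|l - k x| < e / 2 / M.
  by near: x; move/cvgrPdist_lt : kl; exact.
have afx : `|a u - f x u| < e / 2 / K.
  by move: u Au; near: x; exact: fa.
apply: le_lt_trans (ler_normD _ _) _; rewrite (splitr e) !normrM.
apply: ltr_leD.
- apply: (@le_lt_trans _ _ (`|l - k x| * M)); first by rewrite ler_wpM2l// aM.
  by rewrite -ltr_pdivlMr.
- apply: (@le_trans _ _ (K * `|a u - f x u|)); first by rewrite ler_wpM2r.
  by rewrite mulrC -ler_pdivlMr// ltW.
Unshelve. all: by end_near. Qed.

End convergence.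

Section strong_dual.
Context {R : realType} (E : topologicalLmodType R).

(* Bounded in the sense of topological vector spaces: absorbed by every
   neighbourhood of 0 ([bounded_set] needs a norm). *)
Definition vbounded : set (set E) := [set B | forall U : set E, nbhs 0 U ->
  exists2 s : R, 0 < s & forall t : R, s <= `|t| -> B `<=` ( *:%R t @` U)].

Definition dualp : {pred E -> R^o} :=
  mem [set f : E -> R^o | linear f /\ continuous f].

Lemma dualp_submod_closed : submod_closed dualp.
Proof.
split=> [|a f g]; rewrite !inE /=.
  split=> [b u v|]; first by rewrite /GRing.zero /= scaler0 addr0.
  by move=> x; exact: cvg_cst.
move=> [lf cf] [lg cg]; split=> [b u v|x].
  change (a * f (b *: u + v) + g (b *: u + v) =
    b * (a * f u + g u) + (a * f v + g v)).
  rewrite lf lg -[b *: f u]/(b * f u) -[b *: g u]/(b * g u).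
  by rewrite !mulrDr mulrCA addrACA.
apply: (@cvgD _ _ _ _ _ (a *: f) g); last exact: cg.
by apply: (@cvgM _ _ _ _ (cst a) f); [exact: cvg_cst|exact: cf].
Qed.

HB.instance Definition _ :=
  GRing.isSubmodClosed.Build R (E -> R^o) dualp dualp_submod_closed.

Record dual := Dual { dual_fun :> E -> R^o ; _ : dual_fun \in dualp }.

HB.instance Definition _ := [isSub for dual_fun].
HB.instance Definition _ := [Choice of dual by <:].
HB.instance Definition _ := [SubChoice_isSubLmodule of dual by <:].

(* The strong topology: uniform convergence on the bounded subsets of E. *)
HB.instance Definition _ := Topological.copy dual
  (initial_topology (dual_fun : dual -> {family vbounded, E -> R^o})).

Lemma dual_fun_continuous :
  continuous (dual_fun : dual -> {family vbounded, E -> R^o}).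
Proof. exact: initial_continuous. Qed.

Lemma dual_linear (f : dual) : linear f.
Proof. by case: f => f /=; rewrite inE => -[]. Qed.

Lemma dual_continuous (f : dual) : continuous f.
Proof. by case: f => f /=; rewrite inE => -[]. Qed.

Lemma dual_vbounded (f : dual) (B : set E) :
  vbounded B -> exists M : R, forall x, B x -> `|f x| <= M.
Proof.
move=> bB.
have f0 : f 0 = 0.
  by have := dual_linear f (-1) 0 0; rewrite !scaleN1r oppr0 addr0 addNr.
have fZ t x : f (t *: x) = t * f x.
  by have := dual_linear f t x 0; rewrite f0 !addr0.
have U0 : nbhs (0 : E) [set x | `|f x| < 1].
  have /cvgrPdist_lt /(_ 1 ltr01) := @dual_continuous f 0.
  by rewrite f0; apply: filterS => x; rewrite /= sub0r normrN.
have [s s0 /(_ s)] := bB _ U0.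
rewrite (gtr0_norm s0) => /(_ (lexx _)) Bs; exists s => x /Bs [y /= fy <-].
by rewrite fZ normrM (gtr0_norm s0) ler_piMr// ltW.
Qed.

Let dual_add_continuous : continuous (fun x : dual * dual => x.1 + x.2).
Proof.
move=> [a b]; apply: cvg_to_initial.
apply: (@fam_cvgD R E vbounded _ (nbhs (a, b)) (fun x => x.1 : E -> R^o)
  (fun x => x.2 : E -> R^o)).
- exact: (@cvg_fst_comp _ _ _ _ _ _ dual_fun _ (@dual_fun_continuous a)).
- exact: (@cvg_snd_comp _ _ _ _ _ _ dual_fun _ (@dual_fun_continuous b)).
Qed.

Let dual_scale_continuous : continuous (fun z : R^o * dual => z.1 *: z.2).
Proof.
move=> [l a]; apply: cvg_to_initial.
apply: (@fam_cvgZ R E vbounded _ (nbhs (l, a)) (fun x => x.1 : R^o)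
  (fun x => x.2 : E -> R^o)).
- by move=> A; exact: dual_vbounded.
- exact: cvg_fst.
- exact: (@cvg_snd_comp _ _ _ _ _ _ dual_fun _ (@dual_fun_continuous a)).
Qed.

HB.instance Definition _ :=
  PreTopologicalNmodule_isTopologicalNmodule.Build dual dual_add_continuous.
HB.instance Definition _ :=
  TopologicalNmodule_isTopologicalLmodule.Build R dual dual_scale_continuous.

Lemma vbounded1 (x : E) : vbounded [set x].
Proof.
move=> U U0.
have := @scale_continuous R E (0, x) U; rewrite /= scale0r => /(_ U0).
move=> [[V W] /= [/nbhs_ballP[e /= e0 eV] Wx] VWU].
exists (2 / e); first by rewrite divr_gt0.
move=> t et _ ->; have t0 : 0 < `|t| by rewrite (lt_le_trans _ et)// divr_gt0.
have tN0 : t != 0 by rewrite -normr_gt0.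
exists (t^-1 *: x); last by rewrite scalerA divff// scale1r.
apply: (VWU (t^-1, x)); split => /=; last exact: nbhs_singleton.
apply: eV; rewrite /ball /= sub0r normrN normfV invf_plt ?posrE//.
by rewrite (lt_le_trans _ et)// ltr_pdivlMr// mulVf ?ltr1n// gt_eqF.
Qed.

End strong_dual.

Section reflexivity.
Context {R : realType} (E : topologicalLmodType R).

Lemma bidual_evalP (x : E) : (fun f : dual E => f x) \in @dualp R (dual E).
Proof.
rewrite inE /=; split=> [a f g //|f].
have /fam_cvg_normP fc : {family @vbounded R E,
    (@dual_fun R E : dual E -> (E -> R^o)) @ f --> (f : E -> R^o)}.
  exact: dual_fun_continuous.
apply/(@cvgrPdist_lt _ _ _ _ (nbhs_filter f)) => e e0; have := fc _ (vbounded1 x) _ e0.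
by apply: filterS => g /(_ x erefl).
Qed.

Definition bidual_map (x : E) : dual (dual E) := Dual (bidual_evalP x).

(* [bidual_map] is linear because the operations of [dual (dual E)] are
   pointwise, so being an isomorphism onto amounts to being a homeomorphism. *)
Definition reflexive_tvs : Prop := exists g : dual (dual E) -> E,
  [/\ cancel bidual_map g, cancel g bidual_map,
      continuous bidual_map & continuous g].

Definition is_norm (N : E -> R) : Prop :=
  [/\ forall x, N x = 0 -> x = 0,
      forall (a : R) x, N (a *: x) = `|a| * N x &
      forall x y, N (x + y) <= N x + N y].

Definition normable : Prop :=
  exists2 N : E -> R, is_norm N & forall x : E, nbhs x = nbhs_ball_ (ball_ N) x.

End reflexivity.

Section continuous_functions.
Context (R : realType).

Definition contp : {pred R -> R^o} := mem [set f : R -> R^o | continuous f].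

Lemma contp_submod_closed : submod_closed contp.
Proof.
split=> [|a f g]; rewrite !inE /=; first by move=> x; exact: cvg_cst.
move=> cf cg x; apply: (@cvgD _ _ _ _ _ (a *: f) g); last exact: cg.
by apply: (@cvgM _ _ _ _ (cst a) f); [exact: cvg_cst|exact: cf].
Qed.

HB.instance Definition _ :=
  GRing.isSubmodClosed.Build R (R -> R^o) contp contp_submod_closed.

Record CR := MkCR { CR_fun :> R -> R^o ; _ : CR_fun \in contp }.

HB.instance Definition _ := [isSub for CR_fun].
HB.instance Definition _ := [Choice of CR by <:].
HB.instance Definition _ := [SubChoice_isSubLmodule of CR by <:].

HB.instance Definition _ := Topological.copy CR
  (initial_topology (CR_fun : CR -> {family compact, R -> R^o})).

Lemma CR_fun_continuous :
  continuous (CR_fun : CR -> {family compact, R -> R^o}).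
Proof. exact: initial_continuous. Qed.

Lemma CR_continuous (f : CR) : continuous f.
Proof. by case: f => f /=; rewrite inE. Qed.

Lemma CR_compact_bounded (f : CR) (K : set R) :
  compact K -> exists M : R, forall x, K x -> `|f x| <= M.
Proof.
move=> cK; have /compact_bounded [M [_ /(_ (M + 1))]] : compact (f @` K).
  apply: continuous_compact => //.
  by apply: continuous_subspaceT; exact: CR_continuous.
rewrite ltrDl ltr01 => /(_ isT) H; exists (M + 1) => x Kx.
by apply: H; exists x.
Qed.

Let CR_add_continuous : continuous (fun x : CR * CR => x.1 + x.2).
Proof.
move=> [a b]; apply: cvg_to_initial.
apply: (@fam_cvgD R R compact _ (nbhs (a, b)) (fun x => x.1 : R -> R^o)
  (fun x => x.2 : R -> R^o)).
- exact: (@cvg_fst_comp _ _ _ _ _ _ CR_fun _ (@CR_fun_continuous a)).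
- exact: (@cvg_snd_comp _ _ _ _ _ _ CR_fun _ (@CR_fun_continuous b)).
Qed.

Let CR_scale_continuous : continuous (fun z : R^o * CR => z.1 *: z.2).
Proof.
move=> [l a]; apply: cvg_to_initial.
apply: (@fam_cvgZ R R compact _ (nbhs (l, a)) (fun x => x.1 : R^o)
  (fun x => x.2 : R -> R^o)).
- by move=> A; exact: CR_compact_bounded.
- exact: cvg_fst.
- exact: (@cvg_snd_comp _ _ _ _ _ _ CR_fun _ (@CR_fun_continuous a)).
Qed.

HB.instance Definition _ :=
  PreTopologicalNmodule_isTopologicalNmodule.Build CR CR_add_continuous.
HB.instance Definition _ :=
  TopologicalNmodule_isTopologicalLmodule.Build R CR CR_scale_continuous.

Record SF := MkSF {
  SF_set :> set CR ;
  SF_closed : closed SF_set ;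
  SF_submod : submod_closed (mem SF_set)
}.

HB.instance Definition _ := gen_eqMixin SF.
HB.instance Definition _ := gen_choiceMixin SF.

Let SF_setT_submod : submod_closed (mem [set: CR]).
Proof. by split=> [|a f g]; rewrite !inE. Qed.

(* The chosen point is irrelevant: [measurableType] requires one. *)
HB.instance Definition _ := isPointed.Build SF (MkSF closedT SF_setT_submod).

Definition effros : set (set SF) :=
  [set [set X : SF | X `&` U !=set0] | U in [set U : set CR | open U]].

End continuous_functions.

Section subspaces.
Context {R : realType} (X : SF R).

Definition SFp : {pred CR R} := mem (SF_set X).

HB.instance Definition _ :=
  GRing.isSubmodClosed.Build R (CR R) SFp (SF_submod X).

Record SF_tvs := MkSFtvs { SF_val :> CR R ; _ : SF_val \in SFp }.

HB.instance Definition _ := [isSub for SF_val].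
HB.instance Definition _ := [Choice of SF_tvs by <:].
HB.instance Definition _ := [SubChoice_isSubLmodule of SF_tvs by <:].

HB.instance Definition _ := Topological.copy SF_tvs (initial_topology SF_val).

Lemma SF_val_continuous : continuous SF_val.
Proof. exact: initial_continuous. Qed.

Let SF_add_continuous : continuous (fun x : SF_tvs * SF_tvs => x.1 + x.2).
Proof.
move=> [a b]; apply: cvg_to_initial.
move=> P /(@add_continuous (CR R) (SF_val a, SF_val b)) [[U V] /= [Ua Vb] UVP].
exists (SF_val @^-1` U, SF_val @^-1` V) => [|[x y] [Ux Vy]].
  by split=> /=; exact: SF_val_continuous.
exact: (UVP (SF_val x, SF_val y)).
Qed.

Let SF_scale_continuous : continuous (fun z : R^o * SF_tvs => z.1 *: z.2).
Proof.
move=> [l a]; apply: cvg_to_initial.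
move=> P /(@scale_continuous R (CR R) (l, SF_val a)) [[U V] /= [Ul Va] UVP].
exists (U, SF_val @^-1` V) => [|[x y] [Ux Vy]].
  by split=> //=; exact: SF_val_continuous.
exact: (UVP (x, SF_val y)).
Qed.

HB.instance Definition _ :=
  PreTopologicalNmodule_isTopologicalNmodule.Build SF_tvs SF_add_continuous.
HB.instance Definition _ :=
  TopologicalNmodule_isTopologicalLmodule.Build R SF_tvs SF_scale_continuous.

End subspaces.

Definition REFL_notB (R : realType) : set (SF R) :=
  [set X | reflexive_tvs (SF_tvs X) /\ ~ normable (SF_tvs X)].

Section descriptive_set_theory.
Context (R : realType).

Definition is_metric (T : Type) (d : T -> T -> R) : Prop :=
  [/\ forall x y, d x y = 0 <-> x = y,
      forall x y, d x y = d y x &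
      forall x y z, d x z <= d x y + d y z].

Definition metric_cauchy (T : Type) (d : T -> T -> R) (u : nat -> T) : Prop :=
  forall e : R, 0 < e ->
    exists N : nat, forall m n, (N <= m)%N -> (N <= n)%N -> d (u m) (u n) < e.

Definition completely_metrizable (T : topologicalType) : Prop :=
  exists d : T -> T -> R,
    [/\ is_metric d,
        forall x, nbhs x = nbhs_ball_ (fun x e => [set y | d x y < e]) x &
        forall u : nat -> T, metric_cauchy d u -> exists l : T, u @ \oo --> l].

Definition polish (T : topologicalType) : Prop :=
  completely_metrizable T /\ exists2 D : set T, countable D & dense D.

(* [Y] may be empty, so the empty set is analytic. *)
Definition analytic (T : topologicalType) (A : set T) : Prop :=
  exists (Y : topologicalType) (f : Y -> T),
    [/\ polish Y, continuous f & A = range f].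

Definition coanalytic (T : topologicalType) (A : set T) : Prop :=
  analytic (~` A).

(* [measurable_fun] would require [Z] to be pointed, hence nonempty. *)
Definition borel_fun (Z : topologicalType) (d : measure_display)
    (S : measurableType d) (f : Z -> S) : Prop :=
  forall A : set S, measurable A -> <<s [set U : set Z | open U] >> (f @^-1` A).

(* Meant for [S] a standard Borel space. *)
Definition Pi11_hard (d : measure_display) (S : measurableType d)
    (A : set S) : Prop :=
  forall (Z : topologicalType) (B : set Z), polish Z -> coanalytic B ->
    exists2 f : Z -> S, borel_fun f & f @^-1` A = B.

End descriptive_set_theory.

(* Main.v *)
From HB Require Import structures.
Require Import Defs.
From mathcomp Require Import all_boot all_order all_algebra.
From mathcomp Require Import all_classical all_reals all_analysis.
From mathcomp Require Import lra.

Set Implicit Arguments.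
Unset Strict Implicit.
Unset Printing Implicit Defensive.

Import Order.TTheory GRing.Theory Num.Theory.
Import numFieldNormedType.Exports.

Local Open Scope classical_set_scope.
Local Open Scope ring_scope.

(** Let B be coanalytic in a Polish space Z. The complement of B is the result
    of the Suslin operation on a monotone scheme of closed sets F_s indexed by
    the finite sequences s of natural numbers ([analytic_closed_scheme]), so
    z is in B iff the tree T_z = {s | z in F_s} has no infinite branch.

    A tree T is turned into an echelon space of type c_0 that lives inside
    C(R). Fix bumps b_i with pairwise disjoint supports, each of which recurs
    periodically along the line, and weights a_i(t) nondecreasing in t. The
    space [koethe I] is the closed span of the functions a_i b_i, i in I; in
    terms of the coordinates x_i of x its topology is given by the seminorms
    sup_i |x_i| a_i(k). A node s of T contributes the weight
    exp(sum_j s_j max(0, t - j)), and extra indices contribute a copy of the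
    product of countably many lines, whose generators vanish on longer and
    longer half-lines; no norm can see all of these
    ([koethe_not_normable]).

    Reflexivity is decided by the branches of T.
    - At each t the weights of the nodes of a branch are bounded. The partial sums of
      the corresponding generators are then a bounded sequence, and a weak
      cluster point in the space would be a continuous function equal to 1 at
      points that converge to a point where the whole space vanishes
      ([koethe_not_reflexive]).
    - If the space had a bounded set on which the coordinate expansions do not
      converge uniformly, then for some k there would be infinitely many
      indices i with a_i(m) <= C_m a_i(k) for every m. For the exponential
      weights this bounds each entry s_j over the infinitely many nodes s
      involved, and Koenig's lemma yields a branch
      ([koenig_bounded], [tree_space_reflexive]). So without branches the
      expansions converge uniformly on bounded sets, and this gives
      reflexivity: an element xi of the bidual is the evaluation at the
      function t |-> xi(delta_t), where delta_t is the evaluation at t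
      ([reflexive_of_finite_rank]).

    The dependence on z is Borel because the generators do not depend on z:
    the space attached to T_z meets an open set U iff some finite rational
    combination of generators lies in U and uses only indices allowed by T_z
    ([borel_tree_space]). *)

(** * Convergence and boundedness through seminorms *)

Section cvg_criteria.
Context {R : realType}.

Lemma dual_cvgP (E : topologicalLmodType R) (T : Type) (F : set_system T)
    (h : T -> dual E) (g : dual E) : Filter F ->
  (h @ F --> g) <->
  (forall B, vbounded B -> forall e : R, 0 < e ->
    \forall p \near F, forall x, B x -> `|g x - h p x| < e).
Proof.
move=> FF; split=> [hg|H].
  have hg' : {family @vbounded R E, (fun p => h p : E -> R^o) @ F --> (g : E -> R^o)}.
    by apply: (cvg_trans _ (@dual_fun_continuous R E g)); apply: (cvg_app _ hg).
  by apply/fam_cvg_normP.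
apply: cvg_to_initial.
by apply/(@fam_cvg_normP R E (@vbounded R E) T F (fun p => h p : E -> R^o)).
Qed.

Lemma segment_symE (k : R) : [set t : R | `|t| <= k] = `[- k, k]%classic.
Proof.
by apply/seteqP; split=> t /=; rewrite in_itv/= ler_norml.
Qed.

Lemma CR_cvgP (T : Type) (F : set_system T) (h : T -> CR R) (v : CR R) :
  Filter F ->
  (h @ F --> v) <->
  (forall k : nat, forall e : R, 0 < e ->
    \forall p \near F, forall t : R, `|t| <= k%:R -> `|v t - h p t| < e).
Proof.
move=> FF; split=> [hv k e e0|H].
  have : {family @compact R, (fun p => h p : R -> R^o) @ F --> (v : R -> R^o)}.
    by apply: (cvg_trans _ (@CR_fun_continuous R v)); apply: (cvg_app _ hv).
  move/fam_cvg_normP => /(_ [set t : R | `|t| <= k%:R]); apply => //.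
  by rewrite segment_symE; exact: segment_compact.
apply: cvg_to_initial.
apply/(@fam_cvg_normP R R (@compact R) T F (fun p => h p : R -> R^o)).
move=> K cK e e0.
have [M [_ HM]] := compact_bounded cK.
have [k Mk] : exists k : nat, M < k%:R.
  by exists (Num.truncn M).+1; exact: truncnS_gt.
apply: filterS (H k e e0) => p Hp t Kt; apply: Hp; exact: HM.
Qed.

Lemma SF_cvgP (X : SF R) (T : Type) (F : set_system T) (h : T -> SF_tvs X)
    (v : SF_tvs X) : Filter F ->
  (h @ F --> v) <->
  (forall k : nat, forall e : R, 0 < e ->
    \forall p \near F, forall t : R, `|t| <= k%:R ->
      `|SF_val v t - SF_val (h p) t| < e).
Proof.
move=> FF; rewrite -CR_cvgP; split=> [hv|H]; last exact: cvg_to_initial.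
by apply: (cvg_trans _ (@SF_val_continuous R X v)); apply: (cvg_app _ hv).
Qed.

(** Boundedness can be tested on the seminorms sup_A |j v| as soon as these
    describe convergence to 0; both the strong dual and the subspaces of C(R)
    are of this form, which is why the statement is about an arbitrary [j]. *)
Lemma vboundedP (V : topologicalLmodType R) (U : Type) (fam : set U -> Prop)
    (j : V -> U -> R) (B : set V) :
  j 0 = (fun=> 0) ->
  (forall r v u, j (r *: v) u = r * j v u) ->
  (forall (T : Type) (F : set_system T) (h : T -> V), Filter F ->
    (h @ F --> (0 : V)) <-> (forall A, fam A -> forall e : R, 0 < e ->
       \forall p \near F, forall u, A u -> `|j 0 u - j (h p) u| < e)) ->
  vbounded B <->
  (forall A, fam A -> exists M : R, forall v u, B v -> A u -> `|j v u| <= M).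
Proof.
move=> j0 jZ Hcvg; split=> [bB A fA|H U0 nU0].
  have U0 : nbhs (0 : V) [set v | forall u, A u -> `|j v u| < 1].
    have /Hcvg/(_ A fA 1 ltr01) : (id : V -> V) @ nbhs (0 : V) --> (0 : V).
      exact: cvg_id.
    by apply: filterS => v Hv u Au; have := Hv u Au; rewrite j0 sub0r normrN.
  have [s s0 /(_ s)] := bB _ U0.
  rewrite (gtr0_norm s0) => /(_ (lexx _)) Bs; exists s => v u /Bs[w /= Hw <-] Au.
  by rewrite jZ normrM (gtr0_norm s0) ler_piMr ?ltW// Hw.
(* Absorption says that r *: v tends to 0 as r tends to 0, uniformly for v in
   B: this is convergence along the filter below. *)
pose F := filter_prod (nbhs (0 : R^o)) (globally B).
have FF : Filter F by exact: filter_prod_filter.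
have : (fun p : R * V => p.1 *: p.2) @ F --> (0 : V).
  apply/Hcvg => A fA e e0; have [M0 HM0] := H A fA.
  have [M M0' HM] : exists2 M, 0 < M & forall v u, B v -> A u -> `|j v u| <= M.
    exists (`|M0| + 1); first by rewrite ltr_wpDl.
    by move=> v u Bv Au; rewrite (le_trans (HM0 _ _ Bv Au))// ler_wpDr ?ler_norm.
  exists ([set r : R | `|r| < e / M], B) => /=.
    split => //; apply/nbhs_ballP; exists (e / M) => /=; first by rewrite divr_gt0.
    by move=> r; rewrite /ball/= sub0r normrN.
  move=> [r v] /= [re Bv] u Au; rewrite j0 sub0r normrN jZ normrM.
  apply: (@le_lt_trans _ _ (`|r| * M)); first by rewrite ler_wpM2l// HM.
  by rewrite -ltr_pdivlMr.
move=> /(_ U0 nU0) [[W C] /= [/nbhs_ballP[e /= e0 eW] BC] WCU].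
exists (2 / e); first by rewrite divr_gt0.
move=> t et v Bv; have t0 : 0 < `|t| by rewrite (lt_le_trans _ et)// divr_gt0.
have tN0 : t != 0 by rewrite -normr_gt0.
exists (t^-1 *: v); last by rewrite scalerA divff// scale1r.
apply: (WCU (t^-1, v)); split => /=; last exact: BC.
apply: eW; rewrite /ball /= sub0r normrN normfV invf_plt ?posrE//.
by rewrite (lt_le_trans _ et)// ltr_pdivlMr// mulVf ?ltr1n// gt_eqF.
Qed.

Lemma vbounded_dualP (E : topologicalLmodType R) (A : set (dual E)) :
  vbounded A <-> (forall B, vbounded B ->
    exists M : R, forall f x, A f -> B x -> `|f x| <= M).
Proof.
apply: (@vboundedP (dual E) E (@vbounded R E) (fun f x => f x)) => //.
by move=> T F h FF; exact: dual_cvgP.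
Qed.

Lemma vbounded_SFP (X : SF R) (B : set (SF_tvs X)) :
  vbounded B <-> (forall k : nat,
    exists M : R, forall (v : SF_tvs X) t, B v -> `|t| <= k%:R -> `|SF_val v t| <= M).
Proof.
have H := @vboundedP (SF_tvs X) R
  [set [set t | `|t| <= k%:R] | k in [set: nat]] (fun v t => SF_val v t) B.
rewrite H//.
  by split=> [K k|K _ [k _ <-]]; apply: K; exists k.
move=> T F h FF; rewrite SF_cvgP.
by split=> [K _ [k _ <-]|K k]; [apply: K|apply: K; exists k].
Qed.

End cvg_criteria.

(** * Reflexivity of subspaces of C(R) *)

Section dual_arith.
Context {R : realType} (E : topologicalLmodType R).

Lemma dual_near (f : dual E) (B : set E) (e : R) : vbounded B -> 0 < e ->
  nbhs f [set g : dual E | forall x, B x -> `|f x - g x| < e].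
Proof.
by move=> bB; move: e; move: B bB; apply/(dual_cvgP _ _ (nbhs_filter f)).
Qed.

Lemma dual0 (f : dual E) : f 0 = 0.
Proof.
by have := dual_linear f (-1) 0 0; rewrite !scaleN1r oppr0 addr0 addNr.
Qed.

Lemma dualZ (f : dual E) r x : f (r *: x) = r * f x.
Proof. by have := dual_linear f r x 0; rewrite dual0 !addr0. Qed.

Lemma dualD (f : dual E) x y : f (x + y) = f x + f y.
Proof. by have := dual_linear f 1 x y; rewrite !scale1r. Qed.

Lemma dualB (f : dual E) x y : f (x - y) = f x - f y.
Proof. by rewrite dualD -[- y]scaleN1r dualZ mulN1r. Qed.

Lemma dual_sum (f : dual E) n (x : nat -> E) :
  f (\sum_(i < n) x i) = \sum_(i < n) f (x i).
Proof.
elim: n => [|n IH]; first by rewrite !big_ord0 dual0.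
by rewrite !big_ord_recr/= dualD IH.
Qed.

Lemma dual_fun_sum n (f : nat -> dual E) x :
  (\sum_(i < n) f i : dual E) x = \sum_(i < n) f i x.
Proof.
elim: n => [|n IH]; first by rewrite !big_ord0.
by rewrite !big_ord_recr/= -IH.
Qed.

End dual_arith.

Section evaluation.
Context {R : realType} (X : SF R).

Lemma SF_near (x : SF_tvs X) (k : nat) (e : R) : 0 < e ->
  \forall y \near x, forall t : R, `|t| <= k%:R -> `|SF_val x t - SF_val y t| < e.
Proof. by move: k e; apply/(SF_cvgP _ _ (nbhs_filter x)). Qed.

Lemma SF_evalP (t : R) : (fun x : SF_tvs X => SF_val x t) \in @dualp R (SF_tvs X).
Proof.
rewrite inE; split=> [a x y //|x].
have [k tk] : exists k : nat, `|t| <= k%:R.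
  by exists (Num.truncn `|t|).+1; exact/ltW/truncnS_gt.
apply/(@cvgrPdist_lt _ _ _ _ (nbhs_filter x)) => e e0.
by apply: (@filterS _ _ (nbhs_filter x) _ _ _ (SF_near x k e0)) => y /(_ t tk).
Qed.

Definition SF_eval (t : R) : dual (SF_tvs X) := Dual (SF_evalP t).

Lemma vbounded_SF_eval (k : nat) :
  vbounded [set SF_eval t | t in [set t : R | `|t| <= k%:R]].
Proof.
apply/vbounded_dualP => B /vbounded_SFP /(_ k)[M HM].
by exists M => _ x [t tk <-] Bx; exact: HM.
Qed.

Lemma SF_ext (x y : SF_tvs X) : (forall t, SF_val x t = SF_val y t) -> x = y.
Proof. by move=> xy; apply/val_inj/val_inj/funext => t; exact: xy. Qed.

(** Point evaluations already separate the points. *)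
Lemma bidual_map_SF_inj : injective (@bidual_map R (SF_tvs X)).
Proof.
move=> x y xy; apply: SF_ext => t.
by have := congr1 (fun xi : dual (dual (SF_tvs X)) => xi (SF_eval t)) xy.
Qed.

(** Holds because the topology is metrizable. If A is not equicontinuous, there
    are x_n smaller than 1/(n+1) on [-n, n] and f_n in A with |f_n x_n| >= e;
    then (n+1) x_n is a bounded sequence on which A is unbounded. *)
Lemma vbounded_dual_equicontinuous (A : set (dual (SF_tvs X))) :
  vbounded A -> forall e : R, 0 < e -> exists (k : nat) (d : R), 0 < d /\
    forall x : SF_tvs X, (forall t, `|t| <= k%:R -> `|SF_val x t| < d) ->
      forall f, A f -> `|f x| < e.
Proof.
move=> /vbounded_dualP bA e e0; apply: contrapT => H.
have {}H (n : nat) : exists xf : SF_tvs X * dual (SF_tvs X),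
    [/\ forall t, `|t| <= n%:R -> `|SF_val xf.1 t| < n.+1%:R^-1, A xf.2 &
        e * n.+1%:R <= `|xf.2 (n.+1%:R *: xf.1)|].
  apply: contrapT => H'; apply: H; exists n, (n.+1%:R^-1); split.
    by rewrite invr_gt0.
  move=> x xn f Af; rewrite ltNge; apply/negP => ef; apply: H'.
  by exists (x, f); split => //=; rewrite dualZ normrM ger0_norm// mulrC ler_pM2l.
have [xf Hxf] := choice H.
pose y n := n.+1%:R *: (xf n).1.
have : vbounded (range y).
  apply/vbounded_SFP => k.
  have /choice[M HM] (n : nat) : exists M : R,
      forall t, `|t| <= k%:R -> `|SF_val (y n) t| <= M.
    have := @CR_compact_bounded R (SF_val (y n)) [set t | `|t| <= k%:R].
    by apply; rewrite segment_symE; exact: segment_compact.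
  (* From index k on the values are at most 1 on [-k, k]; the k first terms are
     bounded one by one. *)
  exists (1 + \sum_(i < k) `|M i|) => _ t [n _ <-] tk.
  have [kn|nk] := leqP k n.
    rewrite ler_wpDr ?sumr_ge0// /y.
    have [/(_ t) + _ _] := Hxf n.
    rewrite (le_trans tk) ?ler_nat// => /(_ isT) /ltW xn.
    rewrite -[SF_val _ t]/(n.+1%:R * SF_val (xf n).1 t) normrM ger0_norm//.
    by rewrite mulrC -ler_pdivlMr// div1r.
  rewrite ler_wpDl// (le_trans (HM n _ tk))// (le_trans (ler_norm _))//.
  by rewrite (bigD1 (Ordinal nk))//= ler_wpDr ?sumr_ge0.
move=> /bA[M HM].
have [n Mn] : exists n : nat, M / e < n.+1%:R.
  by exists (Num.truncn (M / e)); exact: truncnS_gt.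
have [_ Af ef] := Hxf n.
have := HM _ (y n) Af (imageP _ I); rewrite leNgt => /negP; apply.
by apply: lt_le_trans ef; rewrite mulrC -ltr_pdivrMr.
Qed.

Lemma bidual_map_SF_continuous : continuous (@bidual_map R (SF_tvs X)).
Proof.
move=> x; apply/(dual_cvgP _ _ (nbhs_filter x)) => A bA e e0.
have [k [d [d0 Hd]]] := vbounded_dual_equicontinuous bA e0.
apply: (@filterS _ _ (nbhs_filter x) _ _ _ (@SF_near x k d d0)) => y Hy f Af.
rewrite -[bidual_map x f]/(f x) -[bidual_map y f]/(f y) -dualB.
by apply: Hd Af => t tk; exact: Hy.
Qed.

(** The transposed operators map f to [ap f n], which tends to f in the strong
    dual. For xi in the bidual, xi (ap f n) is the value of f at the vector
    y_n = sum_(i < n) xi(c_i) e_i. For f = delta_t the convergence is uniform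
    for t in compact sets, so y_n converges in the space, to x say, and
    xi f = lim f y_n = f x for every f. *)
Lemma reflexive_of_finite_rank (e_ : nat -> SF_tvs X) (c : nat -> dual (SF_tvs X)) :
  (forall (B : set (SF_tvs X)) (k : nat) (e : R), vbounded B -> 0 < e ->
    exists N : nat, forall n, (N <= n)%N -> forall (x : SF_tvs X) t, B x -> `|t| <= k%:R ->
      `|SF_val (x - \sum_(i < n) c i x *: e_ i) t| < e) ->
  reflexive_tvs (SF_tvs X).
Proof.
move=> approx.
pose ap (f : dual (SF_tvs X)) n : dual (SF_tvs X) := \sum_(i < n) f (e_ i) *: c i.
have apE f n x : ap f n x = f (\sum_(i < n) c i x *: e_ i).
  rewrite /ap (dual_fun_sum n (fun i => f (e_ i) *: c i)).
  rewrite (dual_sum f n (fun i => c i x *: e_ i)).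
  by apply: eq_bigr => i _; rewrite dualZ -[LHS]/(f (e_ i) * c i x) mulrC.
have ap_cvg f : ap f n @[n --> \oo] --> f.
  apply/dual_cvgP => B bB e e0.
  have [k [d [d0 Hd]]] := vbounded_dual_equicontinuous (vbounded1 f) e0.
  have [N HN] := approx B k d bB d0.
  exists N => // n /= Nn x Bx; rewrite apE.
  set s := \sum_(i < n) _.
  rewrite -dualB.
  by apply: (Hd _ _ f erefl) => t tk; exact: HN.
have ap_unif (xi : dual (dual (SF_tvs X))) (k : nat) (e : R) : 0 < e ->
    exists N : nat, forall n, (N <= n)%N -> forall t, `|t| <= k%:R ->
      `|xi (SF_eval t) - xi (ap (SF_eval t) n)| < e.
  move=> e0.
  (* Uniformity in t is convergence along the product of the filter of large n
     with the principal filter of [-k, k]. *)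
  pose F : set_system (nat * R) :=
    filter_prod \oo (globally [set t : R | `|t| <= k%:R]).
  have FF : Filter F by exact: filter_prod_filter.
  have : (fun p : nat * R => ap (SF_eval p.2) p.1 - SF_eval p.2) @ F -->
      (0 : dual (SF_tvs X)).
    apply/dual_cvgP => B bB d d0; have [N HN] := approx B k d bB d0.
    exists ([set n | (N <= n)%N], [set t : R | `|t| <= k%:R]) => /=.
      by split => //; exists N.
    move=> [n t] /= [Nn tk] x Bx.
    change (`|(0 : R) - (ap (SF_eval t) n x - SF_eval t x)| < d).
    by rewrite apE sub0r opprB; exact: HN.
  move=> /(cvg_comp _ _) /(_ (@dual_continuous R _ xi 0)).
  rewrite dual0 => /cvgrPdist_lt /(_ e e0) [[W C] /= [[N _ NW] CC] WC].
  exists N => n Nn t tk.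
  have /WC : (W `*` C) (n, t) by split; [exact: NW|exact: CC].
  by rewrite /= sub0r normrN dualB distrC.
pose y (xi : dual (dual (SF_tvs X))) n : SF_tvs X := \sum_(i < n) xi (c i) *: e_ i.
have xi_ap (xi : dual (dual (SF_tvs X))) f n : xi (ap f n) = f (y xi n).
  rewrite /ap (dual_sum xi n (fun i => f (e_ i) *: c i)).
  rewrite /y (dual_sum f n (fun i => xi (c i) *: e_ i)).
  by apply: eq_bigr => i _; rewrite !dualZ mulrC.
have lift (xi : dual (dual (SF_tvs X))) : exists x, bidual_map x = xi.
  pose x t : R^o := xi (SF_eval t).
  have yx : {family @compact R,
      (fun n => SF_val (y xi n) : R -> R^o) @ \oo --> (x : R -> R^o)}.
    apply/fam_cvg_normP => K cK e e0.
    have [M [_ HM]] := compact_bounded cK.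
    have [k Mk] : exists k : nat, M < k%:R.
      by exists (Num.truncn M).+1; exact: truncnS_gt.
    have [N HN] := ap_unif xi k e e0.
    exists N => // n /= Nn t Kt.
    by rewrite -[SF_val _ t]/(SF_eval t (y xi n)) -xi_ap; apply: HN => //; exact: HM.
  have cx : continuous x.
    move=> t; apply/(@cvgrPdist_lt _ _ _ _ (nbhs_filter t)) => e e0.
    have e30 : 0 < e / 3 by rewrite divr_gt0.
    have [k tk] : exists k : nat, `|t| + 1 < k%:R.
      by exists (Num.truncn (`|t| + 1)).+1; exact: truncnS_gt.
    have [N /(_ N (leqnn _)) HN] := ap_unif xi k _ e30.
    have HN1 r : `|r| <= k%:R -> `|x r - SF_val (y xi N) r| < e / 3.
      by move=> /HN; rewrite xi_ap.
    have /cvgrPdist_lt/(_ _ e30) yt := @CR_continuous R (SF_val (y xi N)) t.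
    near=> r.
    have rk : `|r| <= k%:R.
      have tr : `|t - r| < 1 by near: r; exact: (nbhsx_ballx (t : R^o) _ ltr01).
      have := ler_normD t (r - t); rewrite addrC subrK distrC => /le_trans; apply.
      by rewrite ltW// (le_lt_trans _ tk)// lerD2l ltW.
    have tk' : `|t| <= k%:R by rewrite (le_trans _ (ltW tk))// lerDl.
    have yr : `|SF_val (y xi N) t - SF_val (y xi N) r| < e / 3 by near: r.
    have := HN1 _ rk; have := HN1 _ tk'.
    move: yr; rewrite !ltr_norml; lra.
  have xP : (x : R -> R^o) \in @contp R by rewrite inE.
  have yx' : (fun n => SF_val (y xi n)) @ \oo --> (MkCR xP : CR R).
    exact: cvg_to_initial.
  have Xx : MkCR xP \in SFp X.
    rewrite inE; apply: (closed_cvg _ (@SF_closed _ X) _ _ yx').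
    by apply: nearW => n; have := valP (y xi n); rewrite inE.
  exists (MkSFtvs Xx).
  apply/val_inj/funext => f /=.
  have ylim : y xi n @[n --> \oo] --> MkSFtvs Xx by exact: cvg_to_initial.
  have l1 : f (y xi n) @[n --> \oo] --> f (MkSFtvs Xx).
    exact: (cvg_comp _ _ ylim (@dual_continuous R _ f _)).
  have l2 : f (y xi n) @[n --> \oo] --> xi f.
    under eq_fun do rewrite -xi_ap.
    exact: (cvg_comp _ _ (ap_cvg f) (@dual_continuous R _ xi _)).
  exact: (cvg_unique _ l1 l2).
have [g gK] := choice lift.
exists g; split => //.
- by move=> x; apply: bidual_map_SF_inj; rewrite gK.
- exact: bidual_map_SF_continuous.
- move=> xi; apply/(SF_cvgP _ _ (nbhs_filter xi)) => k e e0.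
  have := dual_near xi (vbounded_SF_eval k) e0.
  apply: (@filterS _ _ (nbhs_filter xi)) => zeta Hz t tk.
  have gE (z : dual (dual (SF_tvs X))) : SF_val (g z) t = z (SF_eval t).
    by rewrite -[in RHS](gK z).
  by rewrite !gE; apply: Hz; exists t.
Unshelve. all: by end_near.
Qed.

End evaluation.

Section bounded_sequences.
Context {R : realType} (E : topologicalLmodType R).

(** Bounded sequences of a reflexive space have weak cluster points: the limit
    along an ultrafilter defines a functional on the strong dual, which is
    continuous because it is bounded by the sup over the sequence. *)
Lemma reflexive_bounded_cluster (y : nat -> E) :
  reflexive_tvs E -> vbounded (range y) ->
  exists x : E, exists F : set_system nat,
    [/\ ProperFilter F, \oo `<=` F & forall f : dual E, f (y n) @[n --> F] --> f x].
Proof.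
move=> [g [_ gK _ _]] by_.
have [F [UF ooF]] := @ultraFilterLemma nat \oo _.
have PF : ProperFilter F := @ultra_proper _ _ UF.
have lim_ex (f : dual E) : exists l : R^o, f (y n) @[n --> F] --> l.
  have [M HM] := dual_vbounded f by_.
  have [|l [_ Hl]] := @segment_compact R (- M) M (f (y n) @[n --> F]).
    apply: (@filterE nat F) => n; have /HM : range y (y n) by exists n.
    by rewrite ler_norml /= in_itv.
  exists l => V Vl; have [//|FV] := in_ultra_setVsetC ((fun n => f (y n)) @^-1` V) UF.
  by have [r []] := Hl (~` V) V FV Vl.
have [L HL] := choice lim_ex.
have LP : L \in @dualp R (dual E).
  rewrite inE; split.
    move=> a f h; apply: (cvg_unique _ (HL _)) => /=; first exact: Rhausdorff.
    have := @cvgD R R^o _ F _ (fun n => a * f (y n)) (fun n => h (y n)).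
    apply; last exact: HL.
    by apply: (@cvgM R _ F _ (fun=> a) (fun n => f (y n))); [exact: cvg_cst|exact: HL].
  move=> f.
  apply/(@cvgrPdist_le _ _ _ _ (nbhs_filter f)) => e e0.
  apply: (@filterS _ _ (nbhs_filter f) _ _ _ (dual_near f by_ e0)) => h fh.
  have : (f (y n) - h (y n)) @[n --> F] --> L f - L h.
    by apply: (@cvgB R R^o); exact: HL.
  move=> /cvg_norm; apply: (closed_cvg (fun r : R => r <= e) (@closed_le _ e)).
  by apply: (@filterE nat F) => n; apply/ltW/fh; exists n.
exists (g (Dual LP)), F; split => // f.
rewrite -[f (g _)]/(bidual_map (g (Dual LP)) f) gK; exact: HL.
Qed.

End bounded_sequences.

(** * Recurring bumps with disjoint supports *)

Section bumps.
Context {R : realType}.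

(** A tent of height 1 centred at 2^-i, evaluated at cos t. The radius 2^-i / 4
    is small enough to make the tents disjoint; the periodicity of cos makes
    every bump reach 1 arbitrarily far to the right. *)
Definition bump (i : nat) (t : R) : R :=
  Num.max 0 (1 - 4 * 2 ^+ i * `|cos t - 2 ^- i|).

Lemma bump_ge0 i t : 0 <= bump i t.
Proof. by rewrite /bump le_max lexx. Qed.

Lemma bump_le1 i t : bump i t <= 1.
Proof.
by rewrite /bump ge_max ler01/= lerBlDr lerDl !mulr_ge0// exprn_ge0.
Qed.

Lemma bump_neq0 i t : bump i t != 0 -> `|cos t - 2 ^- i| < 4^-1 * 2 ^- i.
Proof.
move=> b0; have : 0 < bump i t by rewrite lt_neqAle eq_sym b0 bump_ge0.
rewrite /bump lt_max ltxx/= subr_gt0 => H.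
by rewrite -invfM -[ltRHS]mulr1 ltr_pdivlMl ?mulr_gt0 ?exprn_gt0.
Qed.

Lemma bump_disjoint i j t : i != j -> bump i t != 0 -> bump j t = 0.
Proof.
move=> ij bi; apply/eqP; apply: contraT => bj.
wlog lt_ij : i j ij bi bj / (i < j)%N.
  move=> H; case: (ltngtP i j) => [ij'|ji|ij']; last by rewrite ij' eqxx in ij.
    exact: (H i j).
  by apply: (H j i) => //; rewrite eq_sym.
have := bump_neq0 bi; have := bump_neq0 bj.
have : 2 ^- j <= 2^-1 * 2 ^- i :> R.
  rewrite -invfM -exprS lef_pV2 ?posrE ?exprn_gt0//.
  by rewrite ler_eXn2l// ltr1n.
have : 0 < 2 ^- j :> R by rewrite invr_gt0 exprn_gt0.
move: (2 ^- i) (2 ^- j) (cos t) => p q c q0 qp.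
by rewrite !ltr_norml => /andP[? ?] /andP[? ?]; exfalso; lra.
Qed.

Lemma bump_center i t : cos t = 2 ^- i -> bump i t = 1.
Proof.
by move=> ct; rewrite /bump ct subrr normr0 mulr0 subr0 max_r.
Qed.

(** The centres 2^-i accumulate at 0, which is outside all the tents. *)
Lemma bump_cos0 i t : cos t = 0 -> bump i t = 0.
Proof.
move=> ct; apply/eqP; apply: contraT => /bump_neq0; rewrite ct sub0r normrN.
have p0 : 0 < 2 ^- i :> R by rewrite invr_gt0 exprn_gt0.
rewrite gtr0_norm//; move: (2 ^- i) p0 => p p0 ?; exfalso; lra.
Qed.

Lemma bump_continuous i : continuous (bump i : R -> R^o).
Proof.
move=> t.
apply: (@continuous_max R R (fun=> 0)
  (fun t => 1 - 4 * 2 ^+ i * `|cos t - 2 ^- i|) t); first exact: cvg_cst.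
apply: (@cvgB _ R^o); first exact: cvg_cst.
apply: cvgM; first exact: cvg_cst.
apply: (@cvg_norm _ R^o); apply: (@cvgB _ R^o); last exact: cvg_cst.
exact: continuous_cos.
Qed.

Lemma exp2V_itv i : -1 <= (2 ^- i : R) <= 1.
Proof.
have p0 : 0 <= 2 ^- i :> R by rewrite invr_ge0 exprn_ge0.
rewrite (le_trans (lerN10 R) p0)/=.
by rewrite invf_le1 ?exprn_gt0// exprn_ege1// ler1n.
Qed.

(** A maximum of the bump lying between m and a bound that depends on m only;
    this makes the weight at m controlled by the values of a function on a
    fixed compact set. *)
Definition peak (i m : nat) : R := acos (2 ^- i) + (pi *+ 2) *+ m.

Lemma bump_peak i m : bump i (peak i m) = 1.
Proof.
by apply: bump_center; rewrite /peak (periodicn (@cosD2pi R)) acosK// in_itv/= exp2V_itv.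
Qed.

Lemma peak_ge i m : m%:R <= peak i m.
Proof.
rewrite ler_wpDl ?acos_ge0 ?exp2V_itv// lerMn2r; apply/orP; right.
by have := @pi_ge2 R; rewrite mulr2n; lra.
Qed.

Lemma peak_le i m : peak i m <= (4 + 8 * m)%:R.
Proof.
have pi4 : pi <= 4 :> R by have := @pihalf_lt2 R; lra.
rewrite natrD lerD ?(le_trans (acos_lepi (exp2V_itv i)))//.
rewrite natrM mulr_natr lerMn2r mulr2n; apply/orP; right; lra.
Qed.

(** A maximum on the negative half-line, where the weights of the tree nodes
    are 1. *)
Lemma bump_Nacos i : bump i (- acos (2 ^- i)) = 1.
Proof. by apply: bump_center; rewrite cosN acosK// in_itv/= exp2V_itv. Qed.

End bumps.

(** * Echelon spaces in C(R) *)

Section koethe.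
Context {R : realType} (a : nat -> R -> R)
  (a_cont : forall i, continuous (a i : R -> R^o))
  (a_ge0 : forall i t, 0 <= a i t)
  (a_homo : forall i, {homo a i : s t / s <= t})
  (a_gt0 : forall i, 0 < a i i.+1%:R).

Lemma genP i : (fun t => a i t * bump i t : R^o) \in @contp R.
Proof.
rewrite inE => t; apply: cvgM; first exact: a_cont.
exact: bump_continuous.
Qed.

Definition gen i : CR R := MkCR (genP i).

Lemma genE i t : gen i t = a i t * bump i t.
Proof. by []. Qed.

Lemma gen_disjoint i j t : i != j -> bump i t != 0 -> gen j t = 0.
Proof. by move=> ij bi; rewrite /= (bump_disjoint ij bi) mulr0. Qed.

(** Rational coefficients, so that there are countably many combinations; the
    list representation makes addition a concatenation. *)
Definition comb (l : seq (rat * nat)) : CR R :=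
  \sum_(p <- l) ratr p.1 *: gen p.2.

Definition combs (I : set nat) : set (CR R) :=
  [set comb l | l in [set l : seq (rat * nat) | forall p, p \in l -> I p.2]].

(** Real scalars are reached by approximating them with rationals, the
    operations being continuous. *)
Lemma combs_submod I : submod_closed (mem (closure (combs I))).
Proof.
have combD x y : combs I x -> combs I y -> combs I (x + y).
  move=> [l Il <-] [l' Il' <-]; exists (l ++ l'); last by rewrite /comb big_cat.
  by move=> p; rewrite mem_cat => /orP[/Il|/Il'].
have combZ q x : combs I x -> combs I (ratr q *: x).
  move=> [l Il <-]; exists [seq (q * p.1, p.2) | p <- l].
    by move=> _ /mapP[p /Il Ip ->].
  rewrite /comb big_map scaler_sumr; apply: eq_bigr => p _.
  by rewrite scalerA rmorphM.
split=> [|r x y]; rewrite !inE.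
  by apply: subset_closure; exists [::] => //; rewrite /comb big_nil.
move=> Ix Iy U Uxy.
have [[V W] /= [Vx Wy] VWU] := @add_continuous (CR R) (r *: x, y) U Uxy.
have [[Q P] /= [Qr Px] QPV] := @scale_continuous R (CR R) (r, x) V Vx.
have [x' [Ix' Px']] := Ix _ Px.
have [y' [Iy' Wy']] := Iy _ Wy.
have [q Qq] : exists q : rat, Q (ratr q).
  have := @dense_rat R; rewrite /dense => /(_ (interior Q)) [||s [Qs [q _ qs]]].
  - by exists r; exact: Qr.
  - exact: open_interior.
  by exists q; rewrite qs; exact: interior_subset.
exists (ratr q *: x' + y'); split; first by apply: combD => //; exact: combZ.
by apply: (VWU (ratr q *: x', y')); split => //; apply: (QPV (ratr q, x')).
Qed.

Definition koethe (I : set nat) : SF R :=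
  MkSF (@closed_closure _ (combs I)) (combs_submod I).

Lemma koethe_gen (I : set nat) i : I i -> SF_set (koethe I) (gen i).
Proof.
move=> Ii; apply: subset_closure; exists [:: (1, i)].
  by move=> p; rewrite inE => /eqP ->.
by rewrite /comb big_seq1 rmorph1 scale1r.
Qed.

Lemma koethe_min (I : set nat) (M : set (CR R)) :
  closed M -> submod_closed (mem M) -> (forall i, I i -> M (gen i)) ->
  koethe I `<=` M.
Proof.
move=> cM [M0 MD] MI; rewrite [in X in _ `<=` X](closure_id M).1//.
apply: closureS => _ [l Il <-]; rewrite /comb.
elim: l Il => [_|p l IH Il]; first by rewrite big_nil; rewrite inE in M0.
rewrite big_cons.
have := MD (ratr p.1) (gen p.2) (\sum_(j <- l) ratr j.1 *: gen j.2).
rewrite !inE; apply; first by apply: MI; apply: Il; rewrite mem_head.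
by apply: IH => q ql; apply: Il; rewrite inE ql orbT.
Qed.

(** Pointwise linear relations define closed subspaces, hence pass from the
    generators to the whole space. *)
Lemma koethe_linear_relation (I : set nat) (s t c d : R) (x : CR R) :
  (forall i, I i -> gen i s * c = gen i t * d) ->
  SF_set (koethe I) x -> x s * c = x t * d.
Proof.
move=> Icd; apply: (@koethe_min I [set x : CR R | x s * c = x t * d]) => //.
  have ev r : continuous (fun y : CR R => y r : R^o).
    move=> y; have [k rk] : exists k : nat, `|r| <= k%:R.
      by exists (Num.truncn `|r|).+1; exact/ltW/truncnS_gt.
    apply/(@cvgrPdist_lt _ _ _ _ (nbhs_filter y)) => e e0.
    have /(_ k e e0) H := (CR_cvgP id y (nbhs_filter y)).1 cvg_id.
    by apply: (@filterS _ _ (nbhs_filter y) _ _ _ H) => z /(_ r rk).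
  have -> : [set x : CR R | x s * c = x t * d] =
      (fun y : CR R => y s * c - y t * d : R^o) @^-1` [set 0].
    apply/seteqP; split => y /= => [->|/eqP]; first by rewrite subrr.
    by rewrite subr_eq0 => /eqP.
  apply: preimage_closed => [y _|]; last exact: closed_eq.
  have evM r e : (fun z : CR R => z r * e : R^o) @ nbhs y --> (y r * e : R^o).
    apply: (@cvgM R _ _ (nbhs_filter y) (fun z : CR R => z r) (fun=> e)).
      exact: ev.
    exact: (@cvg_cst _ _ _ _ (nbhs_filter y)).
  exact: (@cvgB R R^o _ _ (nbhs_filter y) (fun z : CR R => z s * c)
    (fun z : CR R => z t * d) _ _ (evM s c) (evM t d)).
split=> [|r y z]; rewrite !inE /=.
  by change ((0 : R) * c = 0 * d); rewrite !mul0r.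
move=> Ey Ez.
change ((r * y s + z s) * c = (r * y t + z t) * d).
by rewrite !mulrDl -!mulrA Ey Ez.
Qed.

(* a i > 0 from i + 1 on, so the i-th generator does not vanish at this peak. *)
Let tau i : R := peak i i.+1.

Let gen_tau i : 0 < gen i (tau i).
Proof.
by rewrite /= bump_peak mulr1 (lt_le_trans (a_gt0 i))// a_homo// peak_ge.
Qed.

Definition coord (I : set nat) i : dual (SF_tvs (koethe I)) :=
  (gen i (tau i))^-1 *: SF_eval _ (tau i).

(** On the support of the i-th bump every element of the space is proportional
    to the i-th generator. *)
Lemma coordE (I : set nat) (x : SF_tvs (koethe I)) i t : bump i t != 0 ->
  SF_val x t = coord I i x * gen i t.
Proof.
move=> bi.
have Xx : SF_set (koethe I) (SF_val x) by have := valP x; rewrite inE.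
have H : SF_val x t * gen i (tau i) = SF_val x (tau i) * gen i t.
  apply: koethe_linear_relation Xx => j Ij.
  have [<-|ij] := eqVneq i j; first by rewrite mulrC.
  by rewrite !(gen_disjoint ij) ?mul0r// bump_peak oner_eq0.
rewrite -[coord I i x]/((gen i (tau i))^-1 * SF_val x (tau i)).
by rewrite -mulrA -H mulrCA mulVf ?mulr1// gt_eqF.
Qed.

Lemma koethe_vanish (I : set nat) (x : CR R) t : SF_set (koethe I) x ->
  (forall i, I i -> bump i t = 0) -> x t = 0.
Proof.
move=> Xx H; have := @koethe_linear_relation I t t 1 0 x; rewrite mulr1 mulr0; apply => //.
by move=> i /H /= ->; rewrite !mulr0 mul0r.
Qed.

Lemma coord_notin (I : set nat) (x : SF_tvs (koethe I)) i : ~ I i ->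
  coord I i x = 0.
Proof.
move=> nI; rewrite -[LHS]/((gen i (tau i))^-1 * SF_val x (tau i)).
have Xx : SF_set (koethe I) (SF_val x) by have := valP x; rewrite inE.
rewrite (koethe_vanish Xx) ?mulr0//.
move=> j Ij; have ij : i != j by apply: contra_notN nI => /eqP ->.
by rewrite (bump_disjoint ij)// bump_peak oner_eq0.
Qed.

Lemma koethe_genP (I : set nat) i : I i -> gen i \in SFp (koethe I).
Proof. by move=> Ii; rewrite inE; exact: koethe_gen. Qed.

(** Outside I the coordinates vanish, so that 0 is a consistent default. *)
Definition kgen (I : set nat) i : SF_tvs (koethe I) :=
  if pselect (I i) is left Ii then MkSFtvs (koethe_genP Ii) else 0.

Lemma kgenE (I : set nat) i : I i -> SF_val (kgen I i) = gen i.
Proof. by rewrite /kgen; case: pselect. Qed.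

Lemma SF_val_sum (X : SF R) (P : pred nat) n (y : nat -> SF_tvs X) t :
  SF_val (\sum_(i < n | P i) y i) t = \sum_(i < n | P i) SF_val (y i) t.
Proof.
rewrite big_mkcond [RHS]big_mkcond /=; elim: n => [|n IH]; first by rewrite !big_ord0.
by rewrite !big_ord_recr/= -IH; case: ifP.
Qed.

(** The hypothesis forbids, on infinitely many indices of I, that all the
    weights a_i(m) be dominated by a single a_i(k). It makes coordinate
    expansions converge uniformly on a bounded set B: if x in B has a value of
    size at least e on [-k, k] in the support of b_i, then |x_i| a_i(k) >= e,
    whereas |x_i| a_i(m) is bounded over B for each m; so i < N. *)
Lemma koethe_reflexive (I : set nat) :
  (forall (k : nat) (C : nat -> R), exists N : nat, forall i, I i ->
    0 < a i k%:R -> (forall m : nat, a i m%:R <= C m * a i k%:R) -> (i < N)%N) ->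
  reflexive_tvs (SF_tvs (koethe I)).
Proof.
move=> Hfin; apply: (reflexive_of_finite_rank (e_ := kgen I) (c := coord I)).
move=> B k e /vbounded_SFP bB e0.
have [M HM] := choice bB.
(* [peak i m] is at most 4 + 8 m, so M (4 + 8 * m) bounds |x_i| a_i(m). *)
have [N HN] := Hfin k (fun m => M (4 + 8 * m)%N / e).
exists N => n Nn x t Bx tk.
have Xx : SF_set (koethe I) (SF_val x) by have := valP x; rewrite inE.
have -> : SF_val (x - \sum_(i < n) coord I i x *: kgen I i) t =
    SF_val x t - \sum_(i < n) coord I i x * gen i t.
  rewrite -[LHS]/(SF_val x t - SF_val (\sum_(i < n) coord I i x *: kgen I i) t).
  rewrite (SF_val_sum xpredT n (fun i => coord I i x *: kgen I i)).
  congr (_ - _); apply: eq_bigr => i _.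
  rewrite -[LHS]/(coord I i x * SF_val (kgen I i) t).
  by have [Ii|nI] := pselect (I i); [rewrite kgenE|rewrite coord_notin// !mul0r].
have [[i [Ii bi]]|H] := pselect (exists i, I i /\ bump i t != 0); last first.
  have b0 i : I i -> bump i t = 0.
    by move=> Ii; apply/eqP; apply: contrapT => /negP bi; apply: H; exists i.
  rewrite (koethe_vanish Xx b0) sub0r normrN big1 ?normr0// => i _.
  have [Ii|nI] := pselect (I i); first by rewrite /= b0// !mulr0.
  by rewrite coord_notin// mul0r.
have other j : j != i -> coord I j x * gen j t = 0.
  by rewrite eq_sym => ij; rewrite (gen_disjoint ij)// mulr0.
have [ni|ni] := ltnP i n.
  rewrite (bigD1 (Ordinal ni))//= big1 => [|j ji]; last exact: other.
  by rewrite addr0 (coordE x bi) subrr normr0.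
rewrite big1 => [|j _]; last first.
  by apply: other; rewrite ltn_eqF// (leq_trans _ ni).
rewrite subr0 ltNge; apply/negP => ex.
suff : (i < N)%N by rewrite ltnNge (leq_trans Nn ni).
have tk' : t <= k%:R by rewrite (le_trans (ler_norm _)).
have ca : e <= `|coord I i x| * a i k%:R.
  rewrite (le_trans ex)// (coordE x bi) [leLHS]normrM ler_wpM2l// genE.
  rewrite normrM !ger0_norm ?bump_ge0// (le_trans _ (a_homo i tk'))//.
  by rewrite ler_piMr// bump_le1.
have ak : 0 < a i k%:R.
  rewrite lt_neqAle a_ge0 andbT eq_sym; apply/eqP => ak.
  by move: ca; rewrite ak mulr0 leNgt e0.
apply: HN => // m.
have c0 : 0 < `|coord I i x|.
  by rewrite -(pmulr_lgt0 _ ak) (lt_le_trans e0).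
have cM : `|coord I i x| * a i m%:R <= M (4 + 8 * m)%N.
  apply: le_trans (HM (4 + 8 * m)%N x (peak i m) Bx _); last first.
    by rewrite ger0_norm ?peak_le// (le_trans _ (peak_ge i m)).
  rewrite (@coordE I x i) ?bump_peak ?oner_eq0// genE bump_peak mulr1 [leRHS]normrM.
  by rewrite ler_wpM2l// (ger0_norm (a_ge0 _ _)) a_homo// peak_ge.
rewrite mulrAC ler_pdivlMr// -(ler_pM2l c0).
have M0 : 0 <= M (4 + 8 * m)%N by rewrite (le_trans _ cM)// mulr_ge0.
apply: (@le_trans _ _ (M (4 + 8 * m)%N * e)).
  by rewrite mulrA ler_wpM2r// ltW.
by rewrite mulrCA ler_wpM2l.
Qed.

(** Normalizing generators that vanish on ]-oo, n] gives unit vectors that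
    tend to 0. *)
Lemma koethe_not_normable (I : set nat) :
  (forall N : nat, exists2 i, I i & forall t, t <= N%:R -> a i t = 0) ->
  ~ normable (SF_tvs (koethe I)).
Proof.
move=> HI [N [N0 NZ ND] nbE].
have Nge0 x : 0 <= N x.
  have := ND x (- x); rewrite subrr -{1}(scale0r x) -scaleN1r !NZ.
  by rewrite normr0 mul0r normrN normr1 mul1r; lra.
have /choice[i_ Hi] (n : nat) : exists i, I i /\ forall t, t <= n%:R -> a i t = 0.
  by have [i Ii ai] := HI n; exists i.
pose x n := kgen I (i_ n).
have Nx n : 0 < N (x n).
  have [In _] := Hi n.
  rewrite lt_neqAle Nge0 andbT eq_sym; apply/eqP => /N0 xn0.
  have := gen_tau (i_ n); rewrite -(kgenE In) -/(x n) xn0.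
  by rewrite (_ : SF_val 0 _ = 0)// ltxx.
have z0 : (N (x n))^-1 *: x n @[n --> \oo] --> (0 : SF_tvs (koethe I)).
  apply/SF_cvgP => k e e0; exists k => // n /= kn t tk.
  have [In ai] := Hi n.
  change (`|(0 : R) - (N (x n))^-1 * SF_val (x n) t| < e).
  rewrite kgenE//= ai ?mul0r ?mulr0 ?subrr ?normr0//.
  by rewrite (le_trans (ler_norm _))// (le_trans tk)// ler_nat.
have [|n _ /(_ n (leqnn n))] := z0 (ball_ N 0 1).
  by rewrite nbE; exists 1 => //=; exact: ltr01.
rewrite /ball_/= sub0r -scaleN1r !NZ normrN normr1 mul1r normfV (ger0_norm (Nge0 _)).
by rewrite mulVf ?ltxx// gt_eqF.
Qed.

(** The partial sums of the generators indexed by J form a bounded sequence. A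
    weak cluster point x takes the value 1 at -acos(2^-i) for i in J, and these
    points accumulate at -acos 0, where x vanishes. *)
Lemma koethe_not_reflexive (I J : set nat) :
  J `<=` I -> (forall N, exists2 i, J i & (N <= i)%N) ->
  (forall i t, J i -> t <= 0 -> a i t = 1) ->
  (forall k : nat, exists M, forall i, J i -> a i k%:R <= M) ->
  ~ reflexive_tvs (SF_tvs (koethe I)).
Proof.
move=> JI Junb J1 Jbnd refl.
pose y n : SF_tvs (koethe I) := \sum_(i < n | (i : nat) \in J) kgen I i.
have yE n i t : bump i t != 0 ->
    SF_val (y n) t = if (i < n)%N && (i \in J) then gen i t else 0.
  move=> bi; rewrite /y (SF_val_sum (fun i => i \in J)).
  have H j : j \in J -> j != i -> SF_val (kgen I j) t = 0.
    rewrite inE eq_sym => /JI Ij ij.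
    by rewrite kgenE// (gen_disjoint ij).
  case: ifPn => [/andP[ni iJ]|ni].
    rewrite (bigD1 (Ordinal ni))//= big1 => [|j /andP[jJ ji]]; last exact: H.
    by rewrite addr0 kgenE//; apply: JI; rewrite inE in iJ.
  rewrite big1// => j jJ; apply: H => //.
  by apply: contraNneq ni => <-; rewrite jJ andbT.
have yb : vbounded (range y).
  apply/vbounded_SFP => k; have [M HM] := Jbnd k.
  exists (Num.max 0 M) => _ t [n _ <-] tk.
  have [[i bi]|H] := pselect (exists i, bump i t != 0); last first.
    have Xy : SF_set (koethe I) (SF_val (y n)) by have := valP (y n); rewrite inE.
    rewrite (koethe_vanish Xy) ?normr0 ?le_max ?lexx//.
    move=> i _; apply/eqP; apply: contrapT => /negP bi; apply: H; by exists i.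
  rewrite (yE n i)//; case: ifP => [/andP[_]|_]; last by rewrite normr0 le_max lexx.
  rewrite inE => iJ; rewrite le_max; apply/orP; right.
  rewrite /= normrM !ger0_norm ?bump_ge0// (le_trans _ (HM _ iJ))//.
  rewrite (@le_trans _ _ (a i t))//; first by rewrite ler_piMr// bump_le1.
  by rewrite a_homo// (le_trans (ler_norm _)).
have [x [F [PF ooF xF]]] := reflexive_bounded_cluster refl yb.
have x1 i : J i -> SF_val x (- acos (2 ^- i)) = 1.
  move=> Ji; have /= h := xF (SF_eval _ (- acos (2 ^- i))).
  apply: (cvg_unique _ h) => /=; first exact: Rhausdorff.
  apply: (@cvg_near_cst _ R^o).
  apply: ooF; exists i.+1 => // n /= ni.
  rewrite (@yE n i) ?bump_Nacos ?oner_eq0// ni/= mem_set// bump_Nacos mulr1.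
  by rewrite J1// oppr_le0 acos_ge0// exp2V_itv.
have x0 : SF_val x (- acos 0) = 0.
  apply: (@koethe_vanish I); first by have := valP x; rewrite inE.
  by move=> i _; apply: bump_cos0; rewrite cosN acosK// in_itv/= lerN10 ler01.
have cx : {for 0, continuous (fun u : R => SF_val x (- acos u) : R^o)}.
  apply: (@continuous_comp _ _ _ (fun u : R => - acos u) (SF_val x : R -> R^o)).
    apply: (@cvgN _ R^o); apply: continuous_acos.
    by rewrite ltrN10 ltr01.
  exact: CR_continuous.
move/cvgrPdist_lt : cx => /(_ 1 ltr01); rewrite x0 => /nbhs_ballP[e /= e0 He].
have [n /= en] : exists n : nat, 2 ^- n < e.
  have [n _ /(_ n (leqnn n))] := near_infty_natSinv_expn_lt (PosNum e0).
  by rewrite div1r; exists n.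
have [i Ji ni] := Junb n.
have /He : ball 0 e (2 ^- i : R).
  rewrite /ball/= sub0r normrN ger0_norm ?invr_ge0 ?exprn_ge0// (le_lt_trans _ en)//.
  by rewrite lef_pV2 ?posrE ?exprn_gt0// ler_eXn2l ?ltr1n.
by rewrite /= x1// sub0r normrN normr1 ltxx.
Qed.

End koethe.

(** * Infinite sets of nodes in trees *)

Section trees.

(** The branch consists of prefixes shared by infinitely many elements of S;
    the bound D makes each of them extend to a longer one. *)
Lemma koenig_bounded (T S : set (seq nat)) (D : nat -> nat) :
  (forall p q, T (p ++ q) -> T p) -> S `<=` T -> infinite_set S ->
  (forall s j, S s -> (j < size s)%N -> (nth 0%N s j <= D j)%N) ->
  exists alpha : nat -> nat, forall n, T (mkseq alpha n).
Proof.
move=> Tpre ST Sinf SD.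
pose big p := infinite_set [set s | S s /\ prefix p s].
have bigT p : big p -> T p.
  move=> bp; have [s [/ST Ts /prefixP[q sE]]] : [set s | S s /\ prefix p s] !=set0.
    by apply/set0P/negP => /eqP p0; apply: bp; rewrite p0; exact: finite_set0.
  by rewrite sE in Ts; exact: Tpre Ts.
have step p : exists j, big p -> big (rcons p j).
  apply: contrapT => H; have [bp|nbp] := pselect (big p); last first.
    by apply: H; exists 0%N.
  apply: bp; have fin j : finite_set [set s | S s /\ prefix (rcons p j) s].
    by apply: contrapT => bj; apply: H; exists j.
  (* An element of S that extends p is p or extends p by an entry at most
     D (size p). *)
  apply: (@sub_finite_set _ _ ([set p] `|` \bigcup_(j in `I_(D (size p)).+1)
      [set s | S s /\ prefix (rcons p j) s])).
    move=> s [Ss /prefixP[[|j q] sE]]; first by left; rewrite sE cats0.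
    right; exists j; last by split => //; rewrite sE -cat_rcons prefix_prefix.
    have := SD s (size p) Ss; rewrite sE nth_cat ltnn subnn /= ltnS; apply.
    by rewrite size_cat /= -[ltnLHS]addn0 ltn_add2l.
  rewrite finite_setU; split; first exact: finite_set1.
  by apply: bigcup_finite => [|j _]; [exact: finite_II|exact: fin].
have [f Hf] := choice step.
pose p n := iter n (fun q => rcons q (f q)) [::].
have pE n : mkseq (fun i => f (p i)) n = p n.
  by elim: n => // n IH; rewrite mkseqS IH.
have bigp n : big (p n).
  elim: n => [|n IH]; last exact: Hf.
  apply: sub_infinite_set Sinf => s Ss; split => //; exact: prefix0s.
by exists (fun i => f (p i)) => n; rewrite pE; exact: bigT.
Qed.

Lemma injective_unbounded (f : nat -> nat) : injective f ->
  forall N, exists n, (N <= f n)%N.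
Proof.
move=> finj N; apply: contrapT => H.
have fN n : (f n < N)%N.
  by rewrite ltnNge; apply/negP => Nf; apply: H; exists n.
pose g (i : 'I_N.+1) : 'I_N := Ordinal (fN i).
have ginj : injective g.
  by move=> i j [] /finj /val_inj.
by have := leq_card g ginj; rewrite !card_ord ltnn.
Qed.

Lemma finite_nat_bounded (A : set nat) : finite_set A ->
  exists N, forall i, A i -> (i < N)%N.
Proof.
move=> /finite_seqP[s ->]; exists (\max_(i <- s) i).+1 => i /= si.
by rewrite ltnS; exact: (@leq_bigmax_seq _ s xpredT id).
Qed.

End trees.

(** * The space attached to a tree *)

Section weights.
Context {R : realType}.

(** The logarithm of the weight of the node s; the entry s_j starts to count at
    time j. *)
Definition growth (s : seq nat) (t : R) : R :=
  \sum_(j < size s) (nth 0%N s j)%:R * Num.max 0 (t - j%:R).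

(** The default value is reached at numbers that code no node, which
    [tree_index] leaves out. *)
Definition decode (i : nat) : seq nat := odflt [::] (unpickle i./2).

(** Odd indices give weights that vanish up to i, for non-normability; even
    indices code the nodes of trees. *)
Definition weight (i : nat) (t : R) : R :=
  if odd i then Num.max 0 (t - i%:R) else expR (growth (decode i) t).

Definition node (s : seq nat) : nat := (pickle s).*2.

Lemma weight_node s t : weight (node s) t = expR (growth s t).
Proof. by rewrite /weight /node odd_double /decode doubleK pickleK. Qed.

Lemma node_inj : injective node.
Proof. by move=> s s' /double_inj /(pcan_inj pickleK). Qed.

Lemma ramp_continuous (c : R) : continuous (fun t : R => Num.max 0 (t - c) : R^o).
Proof.
move=> t; apply: (@continuous_max R R (fun=> 0) (fun t : R => t - c) t).
  exact: cvg_cst.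
by apply: (@cvgB _ R^o); [exact: cvg_id|exact: cvg_cst].
Qed.

Lemma ramp_homo (c : R) : {homo (fun t : R => Num.max 0 (t - c)) : s t / s <= t}.
Proof.
by move=> s t st /=; rewrite ge_max !le_max lexx/= lerD2r st orbT.
Qed.

Lemma growth_continuous s : continuous (growth s : R -> R^o).
Proof.
move=> t; rewrite /growth; apply: cvg_big => [|j _]; first exact: add_continuous.
by apply: cvgM; [exact: cvg_cst|exact: ramp_continuous].
Qed.

Lemma growth_homo s : {homo growth s : t u / t <= u}.
Proof.
by move=> t u tu; apply: ler_sum => j _; rewrite ler_wpM2l// ramp_homo.
Qed.

Lemma weight_continuous i : continuous (weight i : R -> R^o).
Proof.
rewrite /weight => t; case: (odd i); first exact: ramp_continuous.
apply: (@continuous_comp _ _ _ (growth (decode i)) (@expR R)).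
  exact: growth_continuous.
exact: continuous_expR.
Qed.

Lemma weight_ge0 i t : 0 <= weight i t.
Proof. by rewrite /weight; case: ifP; rewrite ?le_max ?lexx// expR_ge0. Qed.

Lemma weight_homo i : {homo weight i : s t / s <= t}.
Proof.
rewrite /weight => s t st; case: (odd i); first exact: ramp_homo.
by rewrite ler_expR growth_homo.
Qed.

Lemma weight_gt0 i : 0 < weight i i.+1%:R.
Proof.
rewrite /weight; case: ifP => _; rewrite ?expR_gt0//.
by rewrite lt_max -natr1 addrAC subrr add0r ltr01 orbT.
Qed.

(** After time j the exponent grows at rate at least s_j, hence by at least s_j
    between max(k, j) and max(k, j) + 1. So a domination a_s(m) <= C_m a_s(k)
    for all m bounds s_j in terms of k, j and C alone. *)
Lemma growth_step s (k j : nat) : (j < size s)%N ->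
  (nth 0%N s j)%:R <= growth s (maxn k j).+1%:R - growth s k%:R.
Proof.
move=> js; rewrite /growth -sumrB (bigD1 (Ordinal js))//= -[leLHS]addr0 lerD//.
  rewrite -mulrBr -[leLHS]mulr1 ler_wpM2l//.
  rewrite lerBrDr [leRHS]max_r; last first.
    by rewrite subr_ge0 ler_nat ltnW// ltnS leq_maxr.
  have kM : k%:R <= (maxn k j)%:R :> R by rewrite ler_nat leq_maxl.
  have jM : j%:R <= (maxn k j)%:R :> R by rewrite ler_nat leq_maxr.
  rewrite -lerBrDl ge_max -natr1; apply/andP; split; lra.
apply: sumr_ge0 => i _; rewrite -mulrBr mulr_ge0// subr_ge0 ramp_homo//.
by rewrite ler_nat leqW// leq_maxl.
Qed.

(** Up to time k only the first k entries count, so the weights are bounded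
    along a branch. *)
Lemma growth_branch (alpha : nat -> nat) n (k : nat) :
  growth (mkseq alpha n) k%:R <= growth (mkseq alpha k) k%:R.
Proof.
rewrite /growth !size_mkseq.
have E m : \sum_(j < m) (nth 0%N (mkseq alpha m) j)%:R * Num.max 0 (k%:R - j%:R)
    = \sum_(j < m) ((alpha j)%:R * Num.max 0 (k%:R - j%:R) : R).
  by apply: eq_bigr => j _; rewrite nth_mkseq.
rewrite !E; pose F j : R := (alpha j)%:R * Num.max 0 (k%:R - j%:R).
rewrite -/(F _); have F0 j : 0 <= F j by rewrite mulr_ge0// le_max lexx.
have Fk j : (k <= j)%N -> F j = 0.
  by move=> kj; rewrite /F max_l ?mulr0// subr_le0 ler_nat.
rewrite -!(big_mkord xpredT F).
have [nk|kn] := leqP n k.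
  by rewrite (big_cat_nat (leq0n n) nk)//= ler_wpDr// sumr_ge0.
rewrite (big_cat_nat (leq0n k) (ltnW kn))//= [X in _ + X]big1_seq ?addr0//.
by move=> j; rewrite mem_index_iota => /= /andP[/Fk].
Qed.

Lemma growth_le0 s t : t <= 0 -> growth s t = 0.
Proof.
move=> t0; rewrite /growth big1// => j _.
by rewrite max_l ?mulr0// subr_le0 (le_trans t0).
Qed.

Definition tree_space (I : set nat) : SF R := koethe weight_continuous I.

Definition tree_index (T : set (seq nat)) : set nat :=
  [set i | odd i \/ exists2 s, i = node s & T s].

Lemma tree_space_not_normable T :
  ~ normable (SF_tvs (tree_space (tree_index T))).
Proof.
apply: koethe_not_normable.
- exact: weight_homo.
- exact: weight_gt0.
- move=> N; exists N.*2.+1; first by left; rewrite /= odd_double.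
  move=> t tN; rewrite /weight /= odd_double/= max_l// subr_le0 (le_trans tN)//.
  by rewrite ler_nat -addnn leqW// leq_addr.
Qed.

(** Infinitely many indices dominated at some k would be, up to finitely many
    odd ones, nodes with uniformly bounded j-th entries for each j, hence would
    give a branch. *)
Lemma tree_space_reflexive (T : set (seq nat)) :
  (forall p q, T (p ++ q) -> T p) ->
  ~ (exists alpha : nat -> nat, forall n, T (mkseq alpha n)) ->
  reflexive_tvs (SF_tvs (tree_space (tree_index T))).
Proof.
move=> Tpre wf.
apply: koethe_reflexive;
  [exact: weight_ge0|exact: weight_homo|exact: weight_gt0|].
move=> k C.
pose J := [set i | [/\ tree_index T i, 0 < weight i k%:R &
  forall m : nat, weight i m%:R <= C m * weight i k%:R]].
suff /finite_nat_bounded[N HN] : finite_set J.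
  by exists N => i Ii ak aC; apply: HN.
pose S := [set s | T s /\ J (node s)].
apply: (@sub_finite_set _ _ (`I_k `|` node @` S)).
  move=> i Ji; have [[oi|[s iE Ts]] ak _] := Ji; last first.
    by right; exists s => //; split => //; rewrite -iE.
  (* The weight of an odd i vanishes at k unless i < k. *)
  left => /=; move: ak; rewrite /weight oi lt_max ltxx/= subr_gt0.
  by rewrite ltr_nat.
rewrite finite_setU; split; first exact: finite_II.
apply: finite_image; apply: contrapT => Sinf; apply: wf.
apply: (@koenig_bounded T S (fun j => (Num.truncn (C (maxn k j).+1)).+1)) => //.
  by move=> s [].
move=> s j [_ [_ _ /(_ (maxn k j).+1)]] + js.
rewrite !weight_node -ler_pdivrMr ?expR_gt0// -expRN -expRD => eC.
rewrite -(ler_nat R) ltW// (le_lt_trans _ (truncnS_gt _))//.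
apply: le_trans eC; apply: le_trans (expR_ge1Dx _).
by rewrite (le_trans (growth_step k js))// lerDr.
Qed.

Lemma tree_space_not_reflexive (T : set (seq nat)) (alpha : nat -> nat) :
  (forall n, T (mkseq alpha n)) ->
  ~ reflexive_tvs (SF_tvs (tree_space (tree_index T))).
Proof.
move=> Ta.
have := @koethe_not_reflexive R weight weight_continuous weight_ge0 weight_homo
  (tree_index T) [set node (mkseq alpha n) | n in [set: nat]].
apply.
- by move=> _ [n _ <-]; right; exists (mkseq alpha n).
- move=> N; have [|n Nn] := @injective_unbounded (fun n => node (mkseq alpha n)) _ N.
    by move=> m n /node_inj /(congr1 size); rewrite !size_mkseq.
  by exists (node (mkseq alpha n)) => //; exists n.
- by move=> _ t [n _ <-] t0; rewrite weight_node growth_le0// expR0.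
- move=> k; exists (expR (growth (mkseq alpha k) k%:R)) => _ [n _ <-].
  by rewrite weight_node ler_expR growth_branch.
Qed.

End weights.

(** * Analytic sets as results of the Suslin operation *)

Section suslin.
Context (R : realType).

Lemma metric_ge0 (T : Type) (d : T -> T -> R) : is_metric d ->
  forall x y, 0 <= d x y.
Proof.
move=> [d0 dC dD] x y; have := dD x y x.
by rewrite (proj2 (d0 x x) erefl) (dC y x); lra.
Qed.

(** Cover the Polish domain, for each j, by the balls of radius 2^-j centred at
    a countable dense set; F_s is the closure of the image of the intersection
    of the balls chosen by s. Along a branch the diameters tend to 0, so
    completeness gives a point l, and z is in the closure of images of sets
    shrinking to l; by continuity z = g l. *)
Lemma analytic_closed_scheme (Z : topologicalType) (A : set Z) :
  completely_metrizable R Z -> analytic R A ->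
  exists F : seq nat -> set Z,
    [/\ forall s, closed (F s), forall p q, F (p ++ q) `<=` F p &
        A = [set z | exists alpha : nat -> nat, forall n, F (mkseq alpha n) z]].
Proof.
move=> [dZ [mZ nbZ _]] [Y [g [[[d [md nbY dcompl]] [D cD dD]] cg ->]]].
have [code codeI] := elimT (countable_injP D) cD.
have [_ dC dT] := md.
have dZge0 := metric_ge0 mZ; have [dZ0 dZC dZT] := mZ.
(* Centres are named by an injective code of the dense set; numbers that code
   nothing give the empty cell. *)
pose cell j c := [set y | exists x, [/\ D x, code x = c & d x y < 2 ^- j]].
pose V (s : seq nat) := [set y | forall j, (j < size s)%N -> cell j (nth 0%N s j) y].
have cell_diam j c y y' : cell j c y -> cell j c y' -> d y y' < 2 * 2 ^- j.
  move=> [x [Dx <- xy]] [x' [Dx' /codeI x'x x'y']].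
  have xx' : x' = x by apply: x'x; rewrite ?inE.
  by have := dT y x y'; rewrite (dC y x); rewrite xx' in x'y'; lra.
have small (e : R) : 0 < e -> exists n : nat, 2 * 2 ^- n < e :> R.
  move=> e0; have e20 : 0 < e / 2 by rewrite divr_gt0.
  have [n _ /(_ n (leqnn n))] := near_infty_natSinv_expn_lt (PosNum e20).
  by rewrite /= div1r => en; exists n; lra.
exists (fun s => closure (g @` V s)); split.
- by move=> s; exact: closed_closure.
- move=> p q; apply: closureS => _ [y Vy <-]; exists y => // j jp.
  have := Vy j; rewrite size_cat nth_cat jp; apply; exact: ltn_addr.
apply/seteqP; split=> [_ [y _ <-]|z [alpha Fz]].
  have near_y j : exists c, cell j c y.
    have nby : nbhs y [set y' | d y y' < 2 ^- j].
      by rewrite nbY; exists (2 ^- j) => //=; rewrite invr_gt0 exprn_gt0.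
    have [||x [Ux Dx]] := dD (interior [set y' | d y y' < 2 ^- j]).
    - by exists y; exact: nby.
    - exact: open_interior.
    exists (code x), x; split => //; rewrite dC.
    by have := interior_subset Ux.
  have [alpha Ha] := choice near_y.
  exists alpha => n; apply: subset_closure; exists y => // j.
  by rewrite size_mkseq => jn; rewrite nth_mkseq.
have Vne n : exists y, V (mkseq alpha n) y.
  by have [_ [[y Vy _] _]] := Fz n setT filterT; exists y.
have [u Hu] := choice Vne.
have Vdiam n m y : (n < m)%N -> V (mkseq alpha m) y -> cell n (alpha n) y.
  move=> nm /(_ n); rewrite size_mkseq => /(_ nm); by rewrite nth_mkseq.
have ucauchy : metric_cauchy d u.
  move=> e e0; have [n ne] := small e e0.
  exists n.+1 => i j ni nj; apply: lt_trans ne.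
  apply: (cell_diam n (alpha n)); first exact: (Vdiam _ _ _ ni (Hu i)).
  exact: (Vdiam _ _ _ nj (Hu j)).
have [l ul] := dcompl u ucauchy.
exists l => //; apply: contrapT => lz.
pose e := dZ (g l) z.
have e0 : 0 < e.
  by rewrite lt_neqAle dZge0 andbT eq_sym; apply/eqP => /dZ0/lz.
have e20 : 0 < e / 2 by rewrite divr_gt0.
have : nbhs l (g @^-1` [set w | dZ (g l) w < e / 2]).
  by apply: cg; rewrite nbZ; exists (e / 2).
rewrite nbY => -[r /= r0 rU].
have [n nr] := small (r / 2) ltac:(by rewrite divr_gt0).
have [|w [[y Vy yw] zw]] := Fz n.+1 [set w | dZ z w < e / 2].
  by rewrite nbZ; exists (e / 2).
have [N _ HN] := ul [set y | d l y < r / 2]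
  ltac:(by rewrite nbY; exists (r / 2) => //=; rewrite divr_gt0).
have lu := HN (maxn N n.+1) (leq_maxl _ _).
have uy : d (u (maxn N n.+1)) y < r / 2.
  apply: lt_trans nr; apply: (cell_diam n (alpha n)).
    by apply: (Vdiam _ _ _ _ (Hu _)); rewrite leq_maxr.
  exact: (Vdiam _ _ _ (ltnSn n) Vy).
have : dZ (g l) (g y) < e / 2.
  by apply: rU => /=; have := dT l (u (maxn N n.+1)) y; rewrite /= in lu; lra.
rewrite yw; have := dZT (g l) w z; rewrite /= dZC in zw; rewrite /e in zw *; lra.
Qed.

End suslin.

(** * Borel dependence on the tree *)

Section borel.
Context {R : realType}.

(** The combinations are dense in the space and U is open. *)
Lemma tree_space_meets (I : set nat) (U : set (CR R)) : open U ->
  tree_space I `&` U !=set0 <->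
  exists2 l, U (comb weight_continuous l) & forall p, p \in l -> I p.2.
Proof.
move=> oU; split=> [[x [Xx Ux]]|[l Ul Il]].
  have [_ [[l Il <-] Ul]] := Xx U (open_nbhs_nbhs (conj oU Ux)).
  by exists l.
by exists (comb weight_continuous l); split => //; apply: subset_closure; exists l.
Qed.

(** By [tree_space_meets], the preimage of a generator of the Effros structure
    is a countable union, over the rational combinations in U, of sets defined
    by finitely many closed conditions on z. *)
Lemma borel_tree_space (Z : topologicalType) (F : seq nat -> set Z) :
  (forall s, closed (F s)) ->
  borel_fun (fun z => tree_space (tree_index [set s | F s z]) :
    g_sigma_algebraType (@effros R)).
Proof.
move=> cF; set f := (X in borel_fun X); set G := <<s [set U : set Z | open U] >>.
have sG : sigma_algebra setT G by exact: smallest_sigma_algebra.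
have [G0 GC GU] := sG.
have [GT _ _ GI] := (sigma_algebraP (fun X _ => @subsetT Z X)).1 sG.
have GF s : G (F s).
  rewrite -(setCK (F s)) -setTD; apply: GC; apply: sub_sigma_algebra.
  exact/closed_openC/cF.
have Gidx i : G [set z | tree_index [set s | F s z] i].
  have [oi|oi] := boolP (odd i).
    by rewrite (_ : [set z | _] = setT)//; apply/seteqP; split => // z _; left.
  have [[s iE]|H] := pselect (exists s, i = node s).
    rewrite (_ : [set z | _] = F s)//; apply/seteqP; split => z.
      by case=> [|[s']]; [rewrite (negbTE oi)|rewrite iE => /node_inj <-].
    by right; exists s.
  rewrite (_ : [set z | _] = set0)//; apply/seteqP; split => // z.
  by case=> [|[s' ? _]]; [rewrite (negbTE oi)|apply: H; exists s'].
have Gl (l : seq (rat * nat)) :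
    G [set z | forall p, p \in l -> tree_index [set s | F s z] p.2].
  elim: l => [|p l IH].
    by rewrite (_ : [set z | _] = setT)//; apply/seteqP; split.
  rewrite (_ : [set z | _] = [set z | tree_index [set s | F s z] p.2] `&`
     [set z | forall p, p \in l -> tree_index [set s | F s z] p.2]); first exact: GI.
  apply/seteqP; split => z /=.
    by move=> H; split => [|q ql]; apply: H; rewrite inE ?eqxx ?ql ?orbT.
  by move=> [Hp Hl] q; rewrite inE => /orP[/eqP ->|/Hl].
suff : <<s @effros R >> `<=` [set A | G (f @^-1` A)] by [].
apply: smallest_sub.
  split => /=.
  - by rewrite preimage_set0.
  - by move=> A GA; rewrite setTD preimage_setC -setTD; exact: GC.
  - by move=> A GA; rewrite preimage_bigcup; exact: GU.
move=> _ [U oU <-] /=.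
pose E n : set Z := if unpickle n is Some l then
  [set z | U (comb weight_continuous l) /\
    forall p, p \in l -> tree_index [set s | F s z] p.2] else set0.
rewrite (_ : _ @^-1` _ = \bigcup_n E n).
  apply: GU => n; rewrite /E; case: unpickle => [l|//].
  have [Ul|nUl] := pselect (U (comb weight_continuous l)).
    rewrite (_ : [set z | _] =
      [set z | forall p, p \in l -> tree_index [set s | F s z] p.2])//.
    by apply/seteqP; split => z // [].
  by rewrite (_ : [set z | _] = set0)//; apply/seteqP; split => z // [].
apply/seteqP; split => z /=.
  move=> /(tree_space_meets _ oU)[l Ul Il].
  by exists (pickle l) => //; rewrite /E pickleK.
move=> [n _]; rewrite /E; case: unpickle => [l [Ul Il]|//].
by apply/(tree_space_meets _ oU); exists l.
Qed.

End borel.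

(** * Hardness *)

Theorem theorem4p33 (R : realType) :
  Pi11_hard R (@REFL_notB R : set (g_sigma_algebraType (@effros R))).
Proof.
move=> Z B [mZ _] /(analytic_closed_scheme mZ)[F [cF Fpre BE]].
exists (fun z => tree_space (tree_index [set s | F s z])).
  exact: borel_tree_space.
apply/seteqP; split => z /=.
  move=> [refl _]; apply: contrapT => nBz.
  have : (~` B) z by [].
  rewrite BE => -[alpha Fa].
  exact: (@tree_space_not_reflexive R [set s | F s z] alpha Fa refl).
move=> Bz; split; last exact: tree_space_not_normable.
apply: tree_space_reflexive => [p q|br]; first exact: Fpre.
by have : (~` B) z by rewrite BE.
Qed.
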